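(* Let $X\subseteq\mathbb{R}^n$ be a polyhedron contained in an open set $\mathcal{O}$, let $b\in\mathbb{R}$, and let $c$, $\varphi_k,g_k$ ($k=1,\dots,K$), $\phi_\ell,h_\ell$ ($\ell=1,\dots,L$) be B-differentiable functions from $\mathcal{O}$ to $\mathbb{R}$. Consider the problem $$(\mathrm{P})\quad \operatorname*{minimize}_{x\in X}\ c(x)+\sum_{k=1}^K\varphi_k(x)\mathbf{1}_{(0,\infty)}(g_k(x))\quad\text{subject to}\quad \sum_{\ell=1}^L\phi_\ell(x)\mathbf{1}_{(0,\infty)}(h_\ell(x))\le b .$$ Assume that $\varphi_k$ is nonnegative on $X\cap g_k^{-1}(0)$ for every $k$ and that $\phi_\ell$ is nonnegative on $X\cap h_\ell^{-1}(0)$ for every $\ell$, and that $c$ and each $\varphi_k$ are Lipschitz continuous on $X$ with Lipschitz constants $\mathrm{Lip}_c$ and $\mathrm{Lip}_\varphi$, respectively. Let $\lambda>\mathrm{Lip}_c+K\,\mathrm{Lip}_\varphi$ and let $(\bar x,\bar t,\bar s)$ be a B-stationary tuple of the penalized epigraphical problem $$\operatorname*{minimize}_{x\in X;\ t\in\mathbb{R}^K;\ s\in\mathbb{R}^L}\ c(x)+\sum_{k=1}^K t_k+\lambda\max\Big(\sum_{\ell=1}^L s_\ell-b,\ 0\Big)$$ $$\text{subject to}\quad t_k\ge\varphi_k(x)\mathbf{1}_{(0,\infty)}(g_k(x))\ \ \forall k=1,\dots,K,\qquad s_\ell\ge\phi_\ell(x)\mathbf{1}_{(0,\infty)}(h_\ell(x))\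 \ \forall \ell=1,\dots,L .$$ Then $\bar x$ is a pseudo B-stationary solution of (P), provided that there exists a vector $\bar v\in\mathcal{T}(\widehat S_{\rm ps}(\bar x);\bar x)$ of unit length satisfying $\sum_{\ell\in\mathcal{L}_>(\bar x)}\phi_\ell'(\bar x;\bar v)\le-1$.
   Context: $\mathbf{1}_{(0,\infty)}(s)=1$ if $s>0$ and $0$ otherwise. A function $\psi:\mathcal{O}\to\mathbb{R}$ is B-differentiable if at every point of $\mathcal{O}$ it is locally Lipschitz continuous and the one-sided directional derivative $\psi'(x;v)=\lim_{\tau\downarrow0}(\psi(x+\tau v)-\psi(x))/\tau$ exists for all $v$. The tangent cone of a closed set $\widehat X$ at $\bar x\in\widehat X$ is $\mathcal{T}(\widehat X;\bar x)=\{v:\exists\,x^\nu\in\widehat X,\ x^\nu\to\bar x,\ \tau_\nu\downarrow0,\ v=\lim_\nu (x^\nu-\bar x)/\tau_\nu\}$. A feasible point $\bar x\in\widehat X$ is B-stationary for minimizing a B-differentiable $\theta$ on the closed set $\widehat X$ if $\theta'(\bar x;v)\ge0$ for all $v\in\mathcal{T}(\widehat X;\bar x)$. (Under the sign assumptions the feasible set of the penalized epigraphical problem is closed; B-stationarity of the tuple is with respect to that feasible set in $(x,t,s)$-space.) Lengths and Lipschitz constants are with respect to the Euclidean norm; $\mathrm{Lip}_\varphi$ is a common Lipschitz constant for all $\varphi_k$. For $\bar x\in X$ let $\mathcal{K}_>(\bar x)=\{k:g_k(\bar x)>0\}$, $\mathcal{K}_\le(\bar x)=\{k:g_k(\bar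 x)\le0\}$, $\mathcal{L}_>(\bar x)=\{\ell:h_\ell(\bar x)>0\}$, $\mathcal{L}_\le(\bar x)=\{\ell:h_\ell(\bar x)\le0\}$. Define $$\widehat S_{\rm ps}(\bar x)=\{x\in X:\ g_k(x)\le0\ \forall k\in\mathcal{K}_\le(\bar x),\ g_k(x)\ge0\ \forall k\in\mathcal{K}_>(\bar x),\ h_\ell(x)\le0\ \forall\ell\in\mathcal{L}_\le(\bar x),\ h_\ell(x)\ge0\ \forall\ell\in\mathcal{L}_>(\bar x)\}$$ and $S_{\rm ps}(\bar x)=\{x\in\widehat S_{\rm ps}(\bar x):\sum_{\ell\in\mathcal{L}_>(\bar x)}\phi_\ell(x)\le b\}$. The vector $\bar x$ is a pseudo B-stationary solution of (P) if $\bar x\in S_{\rm ps}(\bar x)$ and $\bar x$ is a B-stationary point of minimizing $c(x)+\sum_{k\in\mathcal{K}_>(\bar x)}\varphi_k(x)$ over $x\in S_{\rm ps}(\bar x)$. *)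

(* Defs.v *)
(* A function on an open set O is given as a total function; its values outside O
   are irrelevant. *)
From HB Require Import structures.
From mathcomp Require Import all_boot all_order all_algebra.
From mathcomp Require Import all_classical all_reals all_analysis.

Set Implicit Arguments.
Unset Strict Implicit.
Unset Printing Implicit Defensive.

Import Order.TTheory GRing.Theory Num.Theory.
Import numFieldNormedType.Exports.

Local Open Scope classical_set_scope.
Local Open Scope ring_scope.

(* The library norm `|x| on 'rV[R]_n is the sup norm. *)
Definition eucl_norm (R : realType) (n : nat) (x : 'rV[R]_n) : R :=
  Num.sqrt (\sum_(j < n) x 0 j ^+ 2).

Definition eucl_lipschitz (R : realType) (n : nat) (k : R) (A : set 'rV[R]_n)
    (f : 'rV[R]_n -> R) : Prop :=
  forall x y, A x -> A y -> `|f x - f y| <= k * eucl_norm (x - y).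

Definition polyhedron (R : realType) (n : nat) (X : set 'rV[R]_n) : Prop :=
  exists (m : nat) (A : 'M[R]_(n, m)) (a : 'rV[R]_m),
    X = [set x | forall i : 'I_m, (x *m A) 0 i <= a 0 i].

Definition diff_quot (R : realType) (V : normedModType R) (psi : V -> R)
    (x v : V) (tau : R) : R :=
  (psi (x + tau *: v) - psi x) / tau.

(* This is the one-sided derivative when the limit exists, as it does for the
   B-differentiable functions to which it is applied. *)
Definition dirder (R : realType) (V : normedModType R) (psi : V -> R)
    (x v : V) : R :=
  lim (diff_quot psi x v tau @[tau --> 0^'+]).

(* Local Lipschitz continuity does not depend on the choice of an equivalent
   norm, so the library norm is used here. *)
Definition B_differentiable (R : realType) (V : normedModType R) (O : set V)
    (psi : V -> R) : Prop :=
  forall x, O x ->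
    lipschitz_on psi (nbhs (x, x)) /\
    forall v, cvg (diff_quot psi x v tau @[tau --> 0^'+]).

Definition tangent_cone (R : realType) (V : normedModType R) (X : set V)
    (xbar : V) : set V :=
  [set v | exists (x : nat -> V) (tau : nat -> R),
    [/\ forall nu, X (x nu),
        x nu @[nu --> \oo] --> xbar,
        forall nu, 0 < tau nu,
        tau nu @[nu --> \oo] --> 0
      & (tau nu)^-1 *: (x nu - xbar) @[nu --> \oo] --> v]].

Definition B_stationary (R : realType) (V : normedModType R) (theta : V -> R)
    (X : set V) (xbar : V) : Prop :=
  X xbar /\ forall v, tangent_cone X xbar v -> 0 <= dirder theta xbar v.

Definition ind_pos (R : realType) (s : R) : R := \1_[set r : R | 0 < r] s.

Definition penalized_objective (R : realType) (n K L : nat)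
    (c : 'rV[R]_n -> R) (b lambda : R)
    (z : 'rV[R]_n * 'rV[R]_K * 'rV[R]_L) : R :=
  let: (x, t, s) := z in
  c x + \sum_(k < K) t 0 k + lambda * Num.max (\sum_(l < L) s 0 l - b) 0.

Definition epigraphical_set (R : realType) (n K L : nat) (X : set 'rV[R]_n)
    (vphi g : 'I_K -> 'rV[R]_n -> R) (phi h : 'I_L -> 'rV[R]_n -> R) :
    set ('rV[R]_n * 'rV[R]_K * 'rV[R]_L) :=
  [set z : 'rV[R]_n * 'rV[R]_K * 'rV[R]_L | let: (x, t, s) := z in
    [/\ X x,
        forall k, vphi k x * ind_pos (g k x) <= t 0 k
      & forall l, phi l x * ind_pos (h l x) <= s 0 l]].

Definition hatS_ps (R : realType) (n K L : nat) (X : set 'rV[R]_n)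
    (g : 'I_K -> 'rV[R]_n -> R) (h : 'I_L -> 'rV[R]_n -> R)
    (xbar : 'rV[R]_n) : set 'rV[R]_n :=
  [set x | [/\ X x,
    forall k, g k xbar <= 0 -> g k x <= 0,
    forall k, 0 < g k xbar -> 0 <= g k x,
    forall l, h l xbar <= 0 -> h l x <= 0
  & forall l, 0 < h l xbar -> 0 <= h l x]].

Definition S_ps (R : realType) (n K L : nat) (X : set 'rV[R]_n)
    (g : 'I_K -> 'rV[R]_n -> R) (phi h : 'I_L -> 'rV[R]_n -> R) (b : R)
    (xbar : 'rV[R]_n) : set 'rV[R]_n :=
  [set x | hatS_ps X g h xbar x /\ \sum_(l < L | 0 < h l xbar) phi l x <= b].

Definition pseudo_B_stationary (R : realType) (n K L : nat) (X : set 'rV[R]_n)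
    (c : 'rV[R]_n -> R) (vphi g : 'I_K -> 'rV[R]_n -> R)
    (phi h : 'I_L -> 'rV[R]_n -> R) (b : R) (xbar : 'rV[R]_n) : Prop :=
  S_ps X g phi h b xbar xbar /\
  B_stationary (fun x => c x + \sum_(k < K | 0 < g k xbar) vphi k x)
    (S_ps X g phi h b xbar) xbar.

(* Main.v *)
(* Stationarity forces tbar to be tight, and sbar too if its total exceeds b.
   In the latter case one lifts a sequence in hatS_ps tangent to vbar along the
   branches active at xbar: the lifted sequence is feasible because phi_l and
   vphi_k are nonnegative where the indicators switch, and the objective then
   decreases at rate at least lambda - Lip_c - K Lip_vphi > 0, a contradiction.
   Hence the total of sbar is at most b. A sequence in S_ps tangent to v is then
   lifted so that the total of the s-components stays at most b, so the penalty
   contributes nothing to the directional derivative. *)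
Require Import Defs.
From HB Require Import structures.
From mathcomp Require Import all_boot all_order all_algebra.
From mathcomp Require Import all_classical all_reals all_analysis ring lra.

Set Implicit Arguments.
Unset Strict Implicit.
Unset Printing Implicit Defensive.

Import Order.TTheory GRing.Theory Num.Theory.
Import numFieldNormedType.Exports.

Local Open Scope classical_set_scope.
Local Open Scope ring_scope.

(** * Limits of finite sums and row vectors; the Euclidean norm *)

Lemma cvg_sum (T I : Type) (R : realType) (F : set_system T) {FF : Filter F}
    (r : seq I) (P : pred I) (f : I -> T -> R) (a : I -> R) :
  (forall i, P i -> f i x @[x --> F] --> a i) ->
  \sum_(i <- r | P i) f i x @[x --> F] --> \sum_(i <- r | P i) a i.
Proof. by move=> fa; apply: cvg_big => //; exact: add_continuous. Qed.

Lemma cvg_rV (T : Type) (R : realType) (n : nat) (F : set_system T)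
    {FF : Filter F} (u : T -> 'rV[R]_n) (l : 'rV[R]_n) :
  (forall j, u x 0 j @[x --> F] --> l 0 j) -> u x @[x --> F] --> l.
Proof.
move=> ul; apply/cvg_ballP => e e0.
have : \forall x \near F, forall j, ball (l 0 j) e (u x 0 j).
  by apply: filter_forall => j; have /cvg_ballP := ul j; apply.
apply: filterS => x lu; split => // i j; rewrite (ord1 i); exact: lu.
Qed.

Lemma eucl_norm_continuous (R : realType) (n : nat) :
  continuous (@eucl_norm R n).
Proof.
move=> x; rewrite /eucl_norm.
apply: (@continuous_comp _ _ _ (fun y : 'rV[R]_n => \sum_(j < n) y 0 j ^+ 2)).
  apply: (cvg_sum (F := nbhs x)) => j _; rewrite expr2.
  under eq_cvg do rewrite expr2.
  by apply: cvgM; exact: coord_continuous.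
exact: sqrt_continuous.
Qed.

Lemma eucl_normZ (R : realType) (n : nat) (a : R) (x : 'rV[R]_n) :
  0 <= a -> eucl_norm (a *: x) = a * eucl_norm x.
Proof.
move=> a0; rewrite /eucl_norm.
under eq_bigr do rewrite mxE exprMn.
by rewrite -mulr_sumr sqrtrM ?sqr_ge0 // sqrtr_sqr ger0_norm.
Qed.

(** * Tangent sequences and one-sided derivatives *)

Section TangentSequences.
Context {R : realType} {V : normedModType R}.
Implicit Types (S : set V) (xbar v : V) (x : nat -> V) (tau : nat -> R).

(** Since [x nu] is [xbar] plus [tau nu] times a convergent quotient, the convergence of the base
    points required in [tangent_cone] comes for free. *)
Lemma scale_cvg_base xbar v x tau :
  (forall nu, 0 < tau nu) -> tau nu @[nu --> \oo] --> 0 ->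
  (tau nu)^-1 *: (x nu - xbar) @[nu --> \oo] --> v ->
  x nu @[nu --> \oo] --> xbar.
Proof.
move=> tau_gt0 tau0 xv.
have -> : x = fun nu => xbar + tau nu *: ((tau nu)^-1 *: (x nu - xbar)).
  apply/funext => nu.
  by rewrite scalerA divff ?gt_eqF // scale1r addrC subrK.
rewrite -[X in _ --> X]addr0 -(scale0r v).
by apply: cvgD; [exact: cvg_cst|exact: cvgZ].
Qed.

Lemma tangent_cone_seq S xbar v x tau :
  (forall nu, S (x nu)) -> (forall nu, 0 < tau nu) ->
  tau nu @[nu --> \oo] --> 0 ->
  (tau nu)^-1 *: (x nu - xbar) @[nu --> \oo] --> v -> tangent_cone S xbar v.
Proof.
move=> Sx tau_gt0 tau0 xv; exists x, tau; split => //.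
exact: scale_cvg_base xv.
Qed.

(* Local Lipschitz continuity upgrades the radial derivative to arbitrary
   sequences tangent to v. *)
Lemma dirder_seq (psi : V -> R) xbar v x tau :
  lipschitz_on psi (nbhs (xbar, xbar)) ->
  cvg (diff_quot psi xbar v t @[t --> 0^'+]) ->
  (forall nu, 0 < tau nu) -> tau nu @[nu --> \oo] --> 0 ->
  (tau nu)^-1 *: (x nu - xbar) @[nu --> \oo] --> v ->
  (psi (x nu) - psi xbar) / tau nu @[nu --> \oo] --> dirder psi xbar v.
Proof.
move=> psi_lip psi_der tau_gt0 tau0 xv.
(* The local Lipschitz bound holds for all large constants, so a positive one can be chosen. *)
have [M M0 psiM] : exists2 M, 0 < M &
    \forall y \near xbar & z \near xbar, `|psi y - psi z| <= M * `|y - z|.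
  near (+oo : set_system R) => M; exists M; first by near: M; exact: nbhs_pinfty_gt.
  have : \forall yz \near nbhs (xbar, xbar), `|psi yz.1 - psi yz.2| <= M * `|yz.1 - yz.2|.
    by near: M; exact: psi_lip.
  by [].
pose y nu := xbar + tau nu *: v.
have yx : y nu @[nu --> \oo] --> xbar.
  rewrite -[X in _ --> X]addr0 -(scale0r v).
  by apply: cvgD; [exact: cvg_cst|apply: cvgZ => //; exact: cvg_cst].
have xx := scale_cvg_base tau_gt0 tau0 xv.
have xy : \forall nu \near \oo, `|psi (x nu) - psi (y nu)| <= M * `|x nu - y nu|.
  have xyc : (x nu, y nu) @[nu --> \oo] --> (xbar, xbar) by exact: cvg_pair.
  exact: (xyc _ psiM).
(* Compare with the radial quotient at the same step [tau nu]: the two differ by at most [M] times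
   the distance from the scaled increment to [v], which tends to 0. *)
apply: (@cvg_sub0 _ _ _ _ _ _ (fun nu => diff_quot psi xbar v (tau nu))); last first.
  by move/cvg_at_rightP : psi_der; apply; split.
apply: norm_cvg0.
have xv0 : M * `|(tau nu)^-1 *: (x nu - xbar) - v| @[nu --> \oo] --> (0 : R).
  rewrite -[0 in X in _ --> X](mulr0 M); apply: cvgM; first exact: cvg_cst.
  rewrite -[0 in X in _ --> X](@normr0 _ V) -(subrr v).
  by apply: cvg_norm; apply: cvgB => //; exact: cvg_cst.
apply: (@squeeze_cvgr _ _ _ _ (fun=> 0) _ _ _ _ _ xv0); last exact: cvg_cst.
apply: filterS xy => nu xy; rewrite normr_ge0 /=.
rewrite /diff_quot !fctE -mulrBl opprB addrA subrK normrM normfV (gtr0_norm (tau_gt0 nu)).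
rewrite ler_pdivrMr // (le_trans xy) // -mulrA ler_wpM2l ?(ltW M0) //.
rewrite -[X in _ * X](gtr0_norm (tau_gt0 nu)) mulrC -normrZ.
by rewrite scalerBr scalerA divff ?gt_eqF // scale1r /y opprD addrA.
Unshelve. all: by end_near. Qed.

Lemma dirder_sum (I : Type) (r : seq I) (P : pred I) (f : I -> V -> R) xbar v :
  (forall i, P i -> cvg (diff_quot (f i) xbar v t @[t --> 0^'+])) ->
  diff_quot (fun y => \sum_(i <- r | P i) f i y) xbar v t @[t --> 0^'+] -->
    \sum_(i <- r | P i) dirder (f i) xbar v.
Proof.
move=> fcvg; rewrite [X in X @ _ --> _](_ : _ =
    fun t => \sum_(i <- r | P i) diff_quot (f i) xbar v t).
  exact: cvg_sum.
by apply/funext => t; rewrite /diff_quot -mulr_suml sumrB.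
Qed.

End TangentSequences.

Lemma dirder_lipschitz (R : realType) (n : nat) (X : set 'rV[R]_n) (k : R)
    (psi : 'rV[R]_n -> R) (xbar v : 'rV[R]_n) :
  eucl_lipschitz k X psi -> lipschitz_on psi (nbhs (xbar, xbar)) ->
  cvg (diff_quot psi xbar v t @[t --> 0^'+]) ->
  X xbar -> tangent_cone X xbar v ->
  `|dirder psi xbar v| <= k * eucl_norm v.
Proof.
move=> psi_k psi_lip psi_der Xxbar [x [tau [Xx _ tau_gt0 tau0 xv]]].
have normq : `|(psi (x nu) - psi xbar) / tau nu| @[nu --> \oo] -->
    `|dirder psi xbar v|.
  by apply: cvg_norm; exact: dirder_seq.
have kq : k * eucl_norm ((tau nu)^-1 *: (x nu - xbar)) @[nu --> \oo] -->
    k * eucl_norm v.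
  apply: cvgM; first exact: cvg_cst.
  exact: (cvg_comp _ _ xv (@eucl_norm_continuous _ _ _)).
apply: (ler_cvg_to normq kq); apply: nearW => nu /=.
rewrite normrM normfV (gtr0_norm (tau_gt0 nu)) eucl_normZ ?invr_ge0 ?(ltW (tau_gt0 nu)) //.
rewrite mulrCA mulrC ler_wpM2l ?invr_ge0 ?(ltW (tau_gt0 nu)) //.
exact: psi_k.
Qed.

Lemma cvg_pair_pt (T : Type) (U V : topologicalType) (F : set_system T)
    {FF : Filter F} (f : T -> U) (g : T -> V) (a : U) (b : V) :
  f x @[x --> F] --> a -> g x @[x --> F] --> b ->
  (f x, g x) @[x --> F] --> (a, b).
Proof. exact: cvg_pair. Qed.

Lemma tangent_cone_segment (R : realType) (V : normedModType R) (S : set V)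
    (z w : V) (e : R) : 0 < e ->
  (forall t, 0 < t <= e -> S (z + t *: w)) -> tangent_cone S z w.
Proof.
(* [harmonic nu] is 1/(nu+1), so every step lies in the interval (0, e] and the scaled increment is
   constantly [w]. *)
move=> e0 Sz; pose tau nu : R := e * harmonic nu.
have tau_gt0 nu : 0 < tau nu by rewrite mulr_gt0 // invr_gt0 ltr0n.
apply: (@tangent_cone_seq _ _ _ _ _ (fun nu => z + tau nu *: w) tau) => //.
- move=> nu; apply: Sz; rewrite tau_gt0 /= ger_pMr // invf_le1 ?ltr0n //.
  by rewrite ler1n.
- rewrite -[0 in X in _ --> X](mulr0 e).
  by apply: cvgM; [exact: cvg_cst|exact: cvg_harmonic].
- apply: cvg_near_cst; apply: nearW => nu.
  by rewrite addrC addKr scalerA mulVf ?gt_eqF // scale1r.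
Qed.

(** * The indicator and the branches active at the base point *)

Lemma ind_posE (R : realType) (s : R) : ind_pos s = if 0 < s then 1 else 0.
Proof.
rewrite /ind_pos indicE; case: ifPn => s0; first by rewrite mem_set.
by rewrite memNset //=; exact/negP.
Qed.

Section ActivePart.
Context {R : realType} {V : normedModType R}.
Implicit Types (f g : V -> R) (xbar x v : V).

(* The branch of [f * 1_(0,oo)(g)] selected at [xbar], frozen for all [x]. *)
Definition active_part f g xbar x : R := if 0 < g xbar then f x else 0.

Lemma active_part_base f g xbar :
  active_part f g xbar xbar = f xbar * ind_pos (g xbar).
Proof.
by rewrite /active_part ind_posE; case: ifP => _; rewrite ?mulr1 ?mulr0.
Qed.

(** Under the sign conditions both sides agree except when [g xbar] is positive and [g x] vanishes;
    there the left side drops to 0 and the nonnegativity of [f] gives the inequality. *)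
Lemma ind_pos_le_active_part f g xbar x : (g x = 0 -> 0 <= f x) ->
  (g xbar <= 0 -> g x <= 0) -> (0 < g xbar -> 0 <= g x) ->
  f x * ind_pos (g x) <= active_part f g xbar x.
Proof.
move=> f0 gle gge; rewrite /active_part ind_posE.
case: (ltP 0 (g xbar)) => [/gge gx|/gle gx]; last first.
  by rewrite ltNge gx /= mulr0.
case: (ltP 0 (g x)) => [_|gx']; first by rewrite mulr1.
by rewrite mulr0; apply: f0; apply/eqP; rewrite eq_le gx' gx.
Qed.

Lemma active_part_seq f g xbar v (x : nat -> V) (tau : nat -> R) :
  lipschitz_on f (nbhs (xbar, xbar)) ->
  cvg (diff_quot f xbar v t @[t --> 0^'+]) ->
  (forall nu, 0 < tau nu) -> tau nu @[nu --> \oo] --> 0 ->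
  (tau nu)^-1 *: (x nu - xbar) @[nu --> \oo] --> v ->
  (tau nu)^-1 * (active_part f g xbar (x nu) - active_part f g xbar xbar)
    @[nu --> \oo] --> (if 0 < g xbar then dirder f xbar v else 0).
Proof.
move=> f_lip f_der tau_gt0 tau0 xv; rewrite /active_part; case: ifP => _.
  by under eq_cvg do rewrite mulrC; exact: dirder_seq.
by under eq_cvg do rewrite subrr mulr0; exact: cvg_cst.
Qed.

Lemma sum_active_part (L : nat) (f g : 'I_L -> V -> R) xbar x :
  \sum_(l < L) active_part (f l) (g l) xbar x =
  \sum_(l < L | 0 < g l xbar) f l x.
Proof. by rewrite [RHS]big_mkcond. Qed.

End ActivePart.

(** * One-sided slopes of the penalty term *)

Section PenaltyTerm.
Context {R : realType}.
Implicit Types S sigma : R.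

(** For small [t] the argument of the maximum stays nonnegative. The added 1 in the threshold covers
    [sigma = 0]. *)
Lemma max0_der_gt S sigma : 0 < S ->
  \forall t \near 0^'+, Num.max (S + t * sigma) 0 - Num.max S 0 = t * sigma.
Proof.
move=> S0; have e0 : 0 < S / (`|sigma| + 1) by rewrite divr_gt0 // ltr_wpDl.
near=> t; have t0 : 0 < t by near: t; exact: nbhs_right_gt.
have : t < S / (`|sigma| + 1) by near: t; exact: nbhs_right_lt.
rewrite ltr_pdivlMr ?ltr_wpDl // => tS.
have ts : - (t * `|sigma|) <= t * sigma.
  by rewrite -mulrN ler_wpM2l ?(ltW t0) // lerNl ler_normr lexx orbT.
have St0 : 0 <= S + t * sigma by lra.
by rewrite !max_l ?(ltW S0) // addrC addKr.
Unshelve. all: by end_near. Qed.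

(** The kink [S = 0] is harmless only in directions that do not increase the argument. The form
    [t * 0] exhibits the slope 0. *)
Lemma max0_der_le S sigma : S <= 0 -> (S = 0 -> sigma <= 0) ->
  \forall t \near 0^'+, Num.max (S + t * sigma) 0 - Num.max S 0 = t * 0.
Proof.
rewrite le_eqVlt => /predU1P[-> /(_ erefl) sigma0|S0 _].
  near=> t; have t0 : 0 < t by near: t; exact: nbhs_right_gt.
  by rewrite add0r maxxx mulr0 subr0 max_r // mulr_ge0_le0 // ltW.
have e0 : 0 < - S / (`|sigma| + 1) by rewrite divr_gt0 ?oppr_gt0 // ltr_wpDl.
near=> t; have t0 : 0 < t by near: t; exact: nbhs_right_gt.
have : t < - S / (`|sigma| + 1) by near: t; exact: nbhs_right_lt.
rewrite ltr_pdivlMr ?ltr_wpDl // => tS.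
have ts : t * sigma <= t * `|sigma| by rewrite ler_wpM2l ?(ltW t0) // ler_norm.
have St0 : S + t * sigma <= 0 by lra.
by rewrite !max_r ?(ltW S0) // subrr mulr0.
Unshelve. all: by end_near. Qed.

End PenaltyTerm.

(** * Consequences of stationarity for the penalized problem *)

Section Stationarity.
Context {R : realType} {n K L : nat} {X : set 'rV[R]_n} {b lambda : R}.
Context {c : 'rV[R]_n -> R} {vphi g : 'I_K -> 'rV[R]_n -> R}.
Context {phi h : 'I_L -> 'rV[R]_n -> R}.
Context {xbar : 'rV[R]_n} {tbar : 'rV[R]_K} {sbar : 'rV[R]_L}.
Hypothesis stationary : B_stationary (penalized_objective c b lambda)
  (epigraphical_set X vphi g phi h) (xbar, tbar, sbar).

(** Here [m] is the slope of the penalty along [ds]. The t-part is linear and the penalty is affine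
    for small steps, so only the quotient of [c] needs a limit. *)
Lemma penalized_dirder_ge0 (v : 'rV[R]_n) (dt : 'rV[R]_K) (ds : 'rV[R]_L)
    (m : R) :
  tangent_cone (epigraphical_set X vphi g phi h) (xbar, tbar, sbar)
    (v, dt, ds) ->
  cvg (diff_quot c xbar v t @[t --> 0^'+]) ->
  (let S := \sum_(l < L) sbar 0 l - b in \forall t \near 0^'+,
    Num.max (S + t * \sum_(l < L) ds 0 l) 0 - Num.max S 0 = t * m) ->
  0 <= dirder c xbar v + \sum_(k < K) dt 0 k + lambda * m.
Proof.
move=> vT c_der mS; have := stationary.2 _ vT.
rewrite {1}/dirder; set q := diff_quot _ _ _.
suff qc : q t @[t --> 0^'+] -->
    dirder c xbar v + \sum_(k < K) dt 0 k + lambda * m.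
  by rewrite (cvg_lim _ qc).
have : diff_quot c xbar v t + \sum_(k < K) dt 0 k + lambda * m @[t --> 0^'+] -->
    dirder c xbar v + \sum_(k < K) dt 0 k + lambda * m.
  by apply: cvgD; [apply: cvgD|]; [exact: c_der|exact: cvg_cst|exact: cvg_cst].
apply: cvg_trans; apply: near_eq_cvg; near=> t.
have t0 : 0 < t by near: t; exact: nbhs_right_gt.
have mt : Num.max (\sum_(l < L) sbar 0 l - b + t * \sum_(l < L) ds 0 l) 0 -
    Num.max (\sum_(l < L) sbar 0 l - b) 0 = t * m by near: t; exact: mS.
rewrite /q /diff_quot /=.
have -> : \sum_(k < K) (tbar + t *: dt) 0 k =
    \sum_(k < K) tbar 0 k + t * \sum_(k < K) dt 0 k.
  by rewrite mulr_sumr -big_split; apply: eq_bigr => k _; rewrite !mxE.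
have -> : \sum_(l < L) (sbar + t *: ds) 0 l =
    \sum_(l < L) sbar 0 l + t * \sum_(l < L) ds 0 l.
  by rewrite mulr_sumr -big_split; apply: eq_bigr => k _; rewrite !mxE.
rewrite [X in Num.max X](addrAC _ _ (- b)).
move/eqP : mt; rewrite subr_eq => /eqP ->.
by field; rewrite gt_eqF.
Unshelve. all: by end_near. Qed.

Let feasible : epigraphical_set X vphi g phi h (xbar, tbar, sbar).
Proof. exact: stationary.1. Qed.

Lemma diff_quot_dir0 (t : R) : diff_quot c xbar 0 t = 0.
Proof. by rewrite /diff_quot scaler0 addr0 subrr mul0r. Qed.

Lemma dirder_dir0 : dirder c xbar 0 = 0.
Proof.
apply: cvg_lim => //; under eq_cvg do rewrite diff_quot_dir0; exact: cvg_cst.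
Qed.

Lemma cvg_diff_quot_dir0 : cvg (diff_quot c xbar 0 t @[t --> 0^'+]).
Proof.
by under eq_is_cvg do rewrite diff_quot_dir0; exact: is_cvg_cst.
Qed.

Lemma sum_delta_row (m : nat) (i : 'I_m) :
  \sum_(j < m) (- delta_mx 0 i : 'rV[R]_m) 0 j = -1.
Proof.
rewrite (bigD1 i) //= !mxE !eqxx big1 ?addr0 // => j ji.
by rewrite !mxE (negPf ji) andbF oppr0.
Qed.

(** If the constraint had slack, lowering the k-th component alone would be a feasible direction, up
    to a step equal to the slack, with derivative -1. *)
Lemma epigraph_tight_t (k : 'I_K) :
  tbar 0 k = active_part (vphi k) (g k) xbar xbar.
Proof.
have [Xx tge sge] := feasible; apply/eqP; rewrite active_part_base eq_le tge andbT.
rewrite leNgt; apply/negP => slack.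
have T : tangent_cone (epigraphical_set X vphi g phi h) (xbar, tbar, sbar)
    (0, - delta_mx 0 k, 0).
  apply: (@tangent_cone_segment _ _ _ _ _
    (tbar 0 k - vphi k xbar * ind_pos (g k xbar))); first by rewrite subr_gt0.
  move=> t /andP[t0 te]; split; rewrite /= ?scaler0 ?addr0 // => k'.
  rewrite !mxE eqxx /=; have [->|_] := eqVneq k' k.
    by rewrite mulrN1 lerBrDl -lerBrDr.
  by rewrite oppr0 mulr0 addr0.
have mS : \forall t \near (0 : R)^'+,
    Num.max (\sum_(l < L) sbar 0 l - b + t * \sum_(l < L) (0 : 'rV[R]_L) 0 l) 0 -
    Num.max (\sum_(l < L) sbar 0 l - b) 0 = t * 0.
  apply: nearW => t; rewrite [X in t * X]big1 => [|l _]; last by rewrite mxE.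
  by rewrite mulr0 addr0 subrr.
have := penalized_dirder_ge0 T cvg_diff_quot_dir0 mS.
by rewrite dirder_dir0 sum_delta_row mulr0 addr0 add0r ler0N1.
Qed.

(** As for [tbar], but lowering one component pays off only through the penalty: when the total
    exceeds [b], the derivative is [- lambda]. *)
Lemma epigraph_tight_s (l : 'I_L) : 0 < lambda -> b < \sum_(j < L) sbar 0 j ->
  sbar 0 l = active_part (phi l) (h l) xbar xbar.
Proof.
move=> lambda0; rewrite -subr_gt0 => bs.
have [Xx tge sge] := feasible; apply/eqP; rewrite active_part_base eq_le sge andbT.
rewrite leNgt; apply/negP => slack.
have T : tangent_cone (epigraphical_set X vphi g phi h) (xbar, tbar, sbar)
    (0, 0, - delta_mx 0 l).
  apply: (@tangent_cone_segment _ _ _ _ _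
    (sbar 0 l - phi l xbar * ind_pos (h l xbar))); first by rewrite subr_gt0.
  move=> t /andP[t0 te]; split; rewrite /= ?scaler0 ?addr0 // => l'.
  rewrite !mxE eqxx /=; have [->|_] := eqVneq l' l.
    by rewrite mulrN1 lerBrDl -lerBrDr.
  by rewrite oppr0 mulr0 addr0.
have := penalized_dirder_ge0 T cvg_diff_quot_dir0 (max0_der_gt _ bs).
rewrite dirder_dir0 sum_delta_row big1; last by move=> k _; rewrite mxE.
by lra.
Qed.

Hypothesis vphi_ge0 : forall k x, X x -> g k x = 0 -> 0 <= vphi k x.
Hypothesis vphi_lip : forall k, lipschitz_on (vphi k) (nbhs (xbar, xbar)).
Hypothesis vphi_der :
  forall k v, cvg (diff_quot (vphi k) xbar v t @[t --> 0^'+]).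
Hypothesis c_der : forall v, cvg (diff_quot c xbar v t @[t --> 0^'+]).

(* The t-components are lifted along the active branches [active_part (vphi k)],
   which stay above the epigraphical bound on [hatS_ps]. *)
Lemma lifted_stationarity (v : 'rV[R]_n) (ds : 'rV[R]_L) (m : R)
    (x : nat -> 'rV[R]_n) (s : nat -> 'rV[R]_L) (tau : nat -> R) :
  (forall nu, hatS_ps X g h xbar (x nu)) ->
  (forall nu, 0 < tau nu) -> tau nu @[nu --> \oo] --> 0 ->
  (tau nu)^-1 *: (x nu - xbar) @[nu --> \oo] --> v ->
  (forall nu l, phi l (x nu) * ind_pos (h l (x nu)) <= s nu 0 l) ->
  (tau nu)^-1 *: (s nu - sbar) @[nu --> \oo] --> ds ->
  (let S := \sum_(l < L) sbar 0 l - b in \forall t \near 0^'+,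
    Num.max (S + t * \sum_(l < L) ds 0 l) 0 - Num.max S 0 = t * m) ->
  0 <= dirder c xbar v + \sum_(k < K | 0 < g k xbar) dirder (vphi k) xbar v
       + lambda * m.
Proof.
move=> xS tau_gt0 tau0 xv sge sv mS.
pose dt : 'rV[R]_K :=
  \row_k (if 0 < g k xbar then dirder (vphi k) xbar v else 0).
pose t nu : 'rV[R]_K := \row_k active_part (vphi k) (g k) xbar (x nu).
have tv : (tau nu)^-1 *: (t nu - tbar) @[nu --> \oo] --> dt.
  apply: cvg_rV => k; rewrite mxE.
  under eq_cvg do rewrite !mxE epigraph_tight_t.
  exact: active_part_seq.
have xtv : ((tau nu)^-1 *: (x nu - xbar), (tau nu)^-1 *: (t nu - tbar))
    @[nu --> \oo] --> (v, dt) by exact: cvg_pair_pt.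
have T : tangent_cone (epigraphical_set X vphi g phi h) (xbar, tbar, sbar)
    (v, dt, ds).
  apply: (@tangent_cone_seq _ _ _ _ _ (fun nu => (x nu, t nu, s nu)) tau) => //.
    move=> nu; have [Xx gle gge hle hge] := xS nu; split => // k.
    by rewrite mxE; apply: ind_pos_le_active_part; auto.
  exact: cvg_pair_pt xtv sv.
have := penalized_dirder_ge0 T (@c_der v) mS.
by under eq_bigr do rewrite mxE; rewrite -big_mkcond.
Qed.

End Stationarity.

(** * Pseudo B-stationarity of the base point *)

Theorem theorem10 (R : realType) (n K L : nat) (X O : set 'rV[R]_n) (b : R)
  (c : 'rV[R]_n -> R) (vphi g : 'I_K -> 'rV[R]_n -> R)
  (phi h : 'I_L -> 'rV[R]_n -> R) (Lip_c Lip_vphi lambda : R)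
  (xbar : 'rV[R]_n) (tbar : 'rV[R]_K) (sbar : 'rV[R]_L)
  (X_polyhedron : polyhedron X) (O_open : open O) (X_sub_O : X `<=` O)
  (c_Bdiff : B_differentiable O c)
  (vphi_Bdiff : forall k, B_differentiable O (vphi k))
  (g_Bdiff : forall k, B_differentiable O (g k))
  (phi_Bdiff : forall l, B_differentiable O (phi l))
  (h_Bdiff : forall l, B_differentiable O (h l))
  (vphi_ge0 : forall k x, X x -> g k x = 0 -> 0 <= vphi k x)
  (phi_ge0 : forall l x, X x -> h l x = 0 -> 0 <= phi l x)
  (c_Lip : eucl_lipschitz Lip_c X c)
  (vphi_Lip : forall k, eucl_lipschitz Lip_vphi X (vphi k))
  (lambda_gt : Lip_c + K%:R * Lip_vphi < lambda)
  (stationary : B_stationary (penalized_objective c b lambda)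
     (epigraphical_set X vphi g phi h) (xbar, tbar, sbar))
  (vbar_exists : exists vbar : 'rV[R]_n,
     [/\ tangent_cone (hatS_ps X g h xbar) xbar vbar,
         eucl_norm vbar = 1
       & \sum_(l < L | 0 < h l xbar) dirder (phi l) xbar vbar <= -1]) :
  pseudo_B_stationary X c vphi g phi h b xbar.
Proof.
have [Xxbar _ sbar_ge] := stationary.1.
have Oxbar := X_sub_O _ Xxbar.
have [c_lip c_der] := c_Bdiff _ Oxbar.
have vphi_lip k := (vphi_Bdiff k _ Oxbar).1.
have vphi_der k := (vphi_Bdiff k _ Oxbar).2.
have phi_lip l := (phi_Bdiff l _ Oxbar).1.
have phi_der l := (phi_Bdiff l _ Oxbar).2.
have phi_le x l : hatS_ps X g h xbar x ->
    phi l x * ind_pos (h l x) <= active_part (phi l) (h l) xbar x.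
  by move=> [Xx _ _ hle hge]; apply: ind_pos_le_active_part; auto.
have sbar_ge' l : active_part (phi l) (h l) xbar xbar <= sbar 0 l.
  by rewrite active_part_base.
have sbar_le_b : \sum_(l < L) sbar 0 l <= b.
  rewrite leNgt; apply/negP => bs.
  have [vbar [vT v1 phi_v]] := vbar_exists.
  have XT : tangent_cone X xbar vbar.
    by have [x [tau [xS ? ? ? ?]]] := vT; exists x, tau; split => // nu; case: (xS nu).
  have := dirder_lipschitz c_Lip c_lip (c_der vbar) Xxbar XT.
  rewrite v1 mulr1 => c_v.
  have vphi_v k : `|dirder (vphi k) xbar vbar| <= Lip_vphi.
    have := dirder_lipschitz (vphi_Lip k) (vphi_lip k) (vphi_der k vbar) Xxbar XT.
    by rewrite v1 mulr1.
  have vphi_sum : \sum_(k < K | 0 < g k xbar) dirder (vphi k) xbar vbar <=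
      K%:R * Lip_vphi.
    have -> : K%:R * Lip_vphi = \sum_(k < K) Lip_vphi.
      by rewrite sumr_const card_ord mulr_natl.
    (* An inactive index contributes 0, which is at most [Lip_vphi] because [Lip_vphi] bounds an
       absolute value. *)
    rewrite big_mkcond; apply: ler_sum => k _; case: ifP => _.
      exact: le_trans (ler_norm _) (vphi_v k).
    exact: le_trans (normr_ge0 _) (vphi_v k).
  have KLip0 : 0 <= K%:R * Lip_vphi.
    rewrite mulr_natl -[K in _ *+ K]card_ord -sumr_const.
    by apply: sumr_ge0 => k _; exact: le_trans (normr_ge0 _) (vphi_v k).
  have lambda0 : 0 < lambda by have := normr_ge0 (dirder c xbar vbar); lra.
  have [x [tau [xS _ tau_gt0 tau0 xv]]] := vT.
  pose ds : 'rV[R]_L :=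
    \row_l (if 0 < h l xbar then dirder (phi l) xbar vbar else 0).
  pose s nu : 'rV[R]_L := \row_l active_part (phi l) (h l) xbar (x nu).
  have s_feas nu l : phi l (x nu) * ind_pos (h l (x nu)) <= s nu 0 l.
    by rewrite mxE; exact: phi_le.
  have s_ds : (tau nu)^-1 *: (s nu - sbar) @[nu --> \oo] --> ds.
    (* Tightness of [sbar] makes the lifted sequence start from [sbar], so its increments are those
       of the active branches. *)
    apply: cvg_rV => l; rewrite mxE.
    under eq_cvg do rewrite !mxE (epigraph_tight_s stationary _ lambda0 bs).
    exact: active_part_seq.
  have bs' : 0 < \sum_(l < L) sbar 0 l - b by rewrite subr_gt0.
  have := lifted_stationarity stationary vphi_ge0 vphi_lip vphi_der c_der xS
    tau_gt0 tau0 xv s_feas s_ds (max0_der_gt _ bs').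
  have -> : \sum_(l < L) ds 0 l = \sum_(l < L | 0 < h l xbar) dirder (phi l) xbar vbar.
    by under eq_bigr do rewrite mxE; rewrite -big_mkcond.
  (* The stationarity inequality now yields 0 <= [Lip_c + K%:R * Lip_vphi - lambda], contradicting
     the choice of [lambda]. *)
  have := ler_norm (dirder c xbar vbar).
  have : lambda * (\sum_(l < L | 0 < h l xbar) dirder (phi l) xbar vbar) <= - lambda.
    by rewrite -mulrN1 ler_wpM2l // ltW.
  by lra.
have phi_le_b : \sum_(l < L | 0 < h l xbar) phi l xbar <= b.
  by rewrite -sum_active_part (le_trans _ sbar_le_b) // ler_sum.
have hatS_xbar : hatS_ps X g h xbar xbar by split => // ? /ltW.
split => //; split => // v [x [tau [xS _ tau_gt0 tau0 xv]]].
have -> : dirder (fun x => c x + \sum_(k < K | 0 < g k xbar) vphi k x) xbar v =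
    dirder c xbar v + \sum_(k < K | 0 < g k xbar) dirder (vphi k) xbar v.
  apply: cvg_lim => //.
  rewrite [X in X @ _ --> _](_ : _ = fun t => diff_quot c xbar v t +
      diff_quot (fun y => \sum_(k < K | 0 < g k xbar) vphi k y) xbar v t); last first.
    by apply/funext => t; rewrite /diff_quot -mulrDl; congr (_ / _); lra.
  by apply: cvgD; [exact: c_der|apply: dirder_sum => k _; exact: vphi_der].
(* The slack d is shrunk by the factor 1 - delta / D, so that the total of the
   s-components never exceeds b along the sequence; if D = 0 then d = 0, and
   the division by D is harmless. *)
pose psi l := active_part (phi l) (h l) xbar.
pose d l := sbar 0 l - psi l xbar.
pose D := b - \sum_(l < L) psi l xbar.
pose delta nu := \sum_(l < L) psi l (x nu) - \sum_(l < L) psi l xbar.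
pose s nu : 'rV[R]_L := \row_l (psi l (x nu) + (1 - delta nu / D) * d l).
pose dpsi l := if 0 < h l xbar then dirder (phi l) xbar v else 0.
(* Since [sbar 0 l] is [psi l xbar + d l], the increment of [s] is that of [psi l] minus
   [delta nu / D * d l]; [ds] is its scaled limit. *)
pose ds : 'rV[R]_L := \row_l (dpsi l - (\sum_(j < L) dpsi j) / D * d l).
have d_ge0 l : 0 <= d l by rewrite subr_ge0; exact: sbar_ge'.
have sum_d : \sum_(l < L) d l <= D by rewrite sumrB lerB.
have D_ge0 : 0 <= D by rewrite (le_trans _ sum_d) // sumr_ge0.
have delta_le nu : delta nu <= D.
  by rewrite lerB // sum_active_part; exact: (xS nu).2.
have ratio_ge0 nu : 0 <= 1 - delta nu / D.
  have [D0|D0] := eqVneq D 0; first by rewrite D0 invr0 mulr0 subr0.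
  by rewrite subr_ge0 ler_pdivrMr ?mul1r // lt_def D0.
have sum_s nu : \sum_(l < L) s nu 0 l <= b.
  under eq_bigr do rewrite mxE.
  rewrite big_split /= -mulr_sumr.
  have -> : \sum_(l < L) psi l (x nu) = delta nu + (b - D).
    by rewrite /delta /D; lra.
  (* For nonzero [D] the factor times [D] is exactly [D - delta nu]. For [D = 0] the factor is 1,
     and the total of [d] and [delta nu] are both at most 0. *)
  have : (1 - delta nu / D) * \sum_(l < L) d l <= D - delta nu.
    have [D0|D0] := eqVneq D 0.
      by rewrite D0 invr0 mulr0 subr0 mul1r; have := delta_le nu; lra.
    apply: le_trans (ler_wpM2l (ratio_ge0 nu) sum_d) _.
    by rewrite mulrBl mul1r divfK.
  by lra.
have s_feas nu l : phi l (x nu) * ind_pos (h l (x nu)) <= s nu 0 l.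
  rewrite mxE (le_trans (phi_le _ l (xS nu).1)) // lerDl.
  by rewrite mulr_ge0.
have psi_seq l : (tau nu)^-1 * (psi l (x nu) - psi l xbar) @[nu --> \oo] --> dpsi l.
  exact: active_part_seq.
have delta_seq : (tau nu)^-1 * delta nu @[nu --> \oo] --> \sum_(l < L) dpsi l.
  rewrite /delta; under eq_cvg do rewrite -sumrB mulr_sumr.
  by apply: cvg_sum => l _; exact: psi_seq.
have s_seq l : ((tau nu)^-1 *: (s nu - sbar)) 0 l @[nu --> \oo] --> ds 0 l.
  rewrite mxE; under eq_cvg => nu.
    rewrite !mxE.
    rewrite (_ : _ * _ = (tau nu)^-1 * (psi l (x nu) - psi l xbar) -
      (tau nu)^-1 * delta nu / D * d l); last by rewrite /d; ring.
    over.
  apply: cvgB; first exact: psi_seq.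
  by apply: cvgM; [apply: cvgM => //|]; exact: cvg_cst.
(* At the kink of the penalty the total of [sbar] equals [b], which bounds the totals of [s nu];
   their scaled increments are thus nonpositive, and so is the limit. *)
have ds_le0 : \sum_(l < L) sbar 0 l - b = 0 -> \sum_(l < L) ds 0 l <= 0.
  move=> /eqP; rewrite subr_eq0 => /eqP sb.
  have sum_seq : \sum_(l < L) ((tau nu)^-1 *: (s nu - sbar)) 0 l @[nu --> \oo] -->
      \sum_(l < L) ds 0 l by apply: cvg_sum => l _.
  apply: (ler_cvg_to sum_seq (cvg_cst 0)); apply: nearW => nu.
  under eq_bigr do rewrite mxE.
  rewrite -mulr_sumr mulr_ge0_le0 ?invr_ge0 ?(ltW (tau_gt0 nu)) //.
  under eq_bigr do rewrite mxE [(- sbar) _ _]mxE.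
  by rewrite sumrB sb subr_le0.
have sbar_le_b' : \sum_(l < L) sbar 0 l - b <= 0 by rewrite subr_le0.
have xS1 nu := (xS nu).1.
have s_ds : (tau nu)^-1 *: (s nu - sbar) @[nu --> \oo] --> ds by exact: cvg_rV.
have := lifted_stationarity stationary vphi_ge0 vphi_lip vphi_der c_der xS1
  tau_gt0 tau0 xv s_feas s_ds (max0_der_le sbar_le_b' ds_le0).
by rewrite mulr0 addr0.
Qed.
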